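(* Let $g=(c,\mathbb{U}^1,\mathbb{U}^2)$ be a zero-sum game satisfying Assumptions A2 and A4, and let the channels $Q^1,Q^2$ satisfy Assumption A6. For a prior $\zeta\in\mathcal{P}(\mathbb{X})$ let $\mu_\zeta(dx,dy^1,dy^2)=\zeta(dx)Q^1(dy^1|x)Q^2(dy^2|x)$. Let $\zeta_m\to\zeta$ weakly in $\mathcal{P}(\mathbb{X})$, and suppose saddle-point equilibria exist under $\mu_\zeta$ and under each $\mu_{\zeta_m}$. Then $J^*(g,\mu_{\zeta_m})\to J^*(g,\mu_\zeta)$; i.e. the value function is continuous under weak convergence of the priors.
   Context: $\mathbb{X},\mathbb{Y}^1,\mathbb{Y}^2$ are standard Borel spaces; $Q^i$ is a stochastic kernel (measurement channel) from $\mathbb{X}$ to $\mathbb{Y}^i$. A zero-sum game is $g=(c,\mathbb{U}^1,\mathbb{U}^2)$; policies are measurable $\gamma^i:\mathbb{Y}^i\to\mathbb{U}^i$; for an information structure $\mu$ on $\mathbb{X}\times\mathbb{Y}^1\times\mathbb{Y}^2$, $J(g,\mu,\gamma^1,\gamma^2)=\int c(x,\gamma^1(y^1),\gamma^2(y^2))\,d\mu$; Player 1 minimizes, Player 2 maximizes; a saddle point $(\gamma^{1,*},\gamma^{2,*})$ satisfies $\inf_{\gamma^1}J(g,\mu,\gamma^1,\gamma^{2,*})=J(g,\mu,\gamma^{1,*},\gamma^{2,*})=\sup_{\gamma^2}J(g,\mu,\gamma^{1,*},\gamma^2)$, and $J^*(g,\mu)$ is the cost at a saddle point. Weak convergence: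 $\int f\,d\zeta_m\to\int f\,d\zeta$ for all bounded continuous $f$. $\|\cdot\|_{TV}$: $\|P-R\|_{TV}=2\sup_B|P(B)-R(B)|$. Assumptions: A2: the cost is continuous and bounded. A4: each action space is compact. A6: the channels $Q^1,Q^2$ are fixed and conditionally independent given $x$ (so the information structure is $\zeta(dx)Q^1(dy^1|x)Q^2(dy^2|x)$), and each is continuous in total variation: $x_m\to x$ implies $\|Q^i(\cdot|x_m)-Q^i(\cdot|x)\|_{TV}\to0$. *)

(* Defs.v *)
From HB Require Import structures.
From mathcomp Require Import all_boot all_order all_algebra.
From mathcomp Require Import all_classical all_reals all_analysis.
Set Implicit Arguments. Unset Strict Implicit. Unset Printing Implicit Defensive.
Import Order.TTheory GRing.Theory Num.Theory.
Import numFieldTopology.Exports numFieldNormedType.Exports.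
Local Open Scope classical_set_scope.
Local Open Scope ring_scope.

(* A type carrying both a complete pseudometric (hence a topology) and a
   measurable structure; together with [polish_borel] below this models a
   Polish space equipped with its Borel sigma-algebra (a standard Borel space
   with a chosen Polish topology). *)
#[short(type="topoMeasType")]
HB.structure Definition TopoMeas (R : realType) (d : measure_display) :=
  { T of Measurable d T & CompletePseudoMetric R T }.

Definition polish_borel (R : realType) d (T : topoMeasType R d) : Prop :=
  [/\ hausdorff_space T,
      (exists D : set T, countable D /\ dense D) &
      (forall A : set T, measurable A <-> <<s open >> A)].

Local Open Scope ereal_scope.

Definition tv_dist (R : realType) d (Y : measurableType d)
    (P Q : set Y -> \bar R) : \bar R :=
  2%:E * ereal_sup [set `|P B - Q B| | B in [set B : set Y | measurable B]].

(* expected cost J(g, mu_zeta, g1, g2) with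
   mu_zeta(dx,dy1,dy2) = zeta(dx) Q1(dy1|x) Q2(dy2|x), written as the
   iterated integral against this information structure. *)
Definition Jcost (R : realType) dX dY1 dY2 dU1 dU2
    (X : topoMeasType R dX) (Y1 : topoMeasType R dY1) (Y2 : topoMeasType R dY2)
    (U1 : topoMeasType R dU1) (U2 : topoMeasType R dU2)
    (c : (X * U1 * U2)%type -> R) (Q1 : R.-pker X ~> Y1) (Q2 : R.-pker X ~> Y2)
    (zeta : probability X R) (g1 : Y1 -> U1) (g2 : Y2 -> U2) : \bar R :=
  \int[zeta]_x \int[Q1 x]_y1 \int[Q2 x]_y2 (c (x, g1 y1, g2 y2))%:E.

Definition saddle_point (R : realType) dX dY1 dY2 dU1 dU2
    (X : topoMeasType R dX) (Y1 : topoMeasType R dY1) (Y2 : topoMeasType R dY2)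
    (U1 : topoMeasType R dU1) (U2 : topoMeasType R dU2)
    (c : (X * U1 * U2)%type -> R) (Q1 : R.-pker X ~> Y1) (Q2 : R.-pker X ~> Y2)
    (zeta : probability X R) (g1s : Y1 -> U1) (g2s : Y2 -> U2) : Prop :=
  let J := Jcost c Q1 Q2 zeta in
  [/\ measurable_fun setT g1s, measurable_fun setT g2s,
      ereal_inf [set J g1 g2s | g1 in [set g : Y1 -> U1 | measurable_fun setT g]]
        = J g1s g2s &
      J g1s g2s
        = ereal_sup [set J g1s g2 | g2 in [set g : Y2 -> U2 | measurable_fun setT g]]].

Definition weak_cvg (R : realType) d (X : topoMeasType R d)
    (zs : nat -> probability X R) (z : probability X R) : Prop :=
  forall f : X -> R, continuous f -> (exists M : R, forall x, (`|f x| <= M)%R) ->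
    \int[zs n]_x (f x)%:E @[n --> \oo] --> \int[z]_x (f x)%:E.

Definition tv_continuous (R : realType) dX dY
    (X : topoMeasType R dX) (Y : measurableType dY) (Q : R.-pker X ~> Y) : Prop :=
  forall (xs : nat -> X) (x : X), xs n @[n --> \oo] --> x ->
    tv_dist (Q (xs n)) (Q x) @[n --> \oo] --> 0.

(* Main.v *)
Require Import Defs.
From HB Require Import structures.
From mathcomp Require Import all_boot all_order all_algebra.
From mathcomp Require Import all_classical all_reals all_analysis.
From mathcomp Require Import ring lra.
Import Order.TTheory GRing.Theory Num.Theory.
Import numFieldTopology.Exports numFieldNormedType.Exports.
Local Open Scope classical_set_scope.
Local Open Scope ring_scope.

(* If the payoffs [J_m] converge to [J] uniformly over all pairs of policies,
   playing one player's optimal policy for [zeta] against the other's optimal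
   policy for [zeta_m] sandwiches the saddle values. Uniformity holds because
   integrating out the observations leaves functions of [x] alone which, as the
   policies vary, are bounded and equicontinuous: the cost moves little with [x]
   uniformly over the compact action spaces, and the channels move little in
   total variation. Weak convergence is uniform over such a family
   (Ranga Rao). *)

(** * Integrals of bounded functions against a probability measure *)

Section bounded_integrals.
Context {d} {T : measurableType d} {R : realType}.
Variables (mu : {measure set T -> \bar R}) (mu1 : mu setT = 1%E).
Implicit Types (f g : T -> R) (M a : R).

Lemma bounded_integrable f M : measurable_fun setT f ->
  (forall x, `|f x| <= M) -> mu.-integrable setT (EFin \o f).
Proof.
move=> mf fM; apply: measurable_bounded_integrable => //.
  by rewrite mu1 ltry.
exists M; split; rewrite ?num_real// => r Mr x _ /=.
exact: le_trans (fM x) (ltW Mr).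
Qed.

Lemma EFin_Rintegral f M : measurable_fun setT f ->
  (forall x, `|f x| <= M) ->
  (\int[mu]_x (f x)%:E)%E = (\int[mu]_x f x)%:E.
Proof.
move=> mf fM; rewrite /Rintegral fineK//.
exact/integrable_fin_num/(bounded_integrable f M).
Qed.

Lemma Rintegral_bound f M : measurable_fun setT f ->
  (forall x, `|f x| <= M) -> `|\int[mu]_x f x| <= M.
Proof.
move=> mf fM; have intf := bounded_integrable f M mf fM.
apply: le_trans (le_normr_Rintegral _ _) _ => //.
have -> : M = \int[mu]_x (cst M x).
  by rewrite Rintegral_cst// mu1 mulr1.
apply: le_Rintegral => //.
- apply: (bounded_integrable _ M); last by move=> x; rewrite normr_id.
  exact: measurableT_comp.
- exact: (bounded_integrable (cst M) `|M|).
Qed.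

Lemma Rintegral_dist f g M a : measurable_fun setT f -> measurable_fun setT g ->
  (forall x, `|f x| <= M) -> (forall x, `|g x| <= M) ->
  (forall x, `|f x - g x| <= a) -> `|\int[mu]_x f x - \int[mu]_x g x| <= a.
Proof.
move=> mf mg fM gM fga; rewrite -RintegralB//.
- by apply: Rintegral_bound => //; exact: measurable_realfun.measurable_funB.
- exact: bounded_integrable fM.
- exact: bounded_integrable gM.
Qed.

Lemma bounded_sum (f : nat -> T -> R) (M : nat -> R) n :
  (forall k x, `|f k x| <= M k) ->
  forall x, `|\sum_(k < n) f k x| <= \sum_(k < n) M k.
Proof. by move=> fM x; apply: le_trans (ler_norm_sum _ _ _) (ler_sum _ _). Qed.

Lemma Rintegral_sum (f : nat -> T -> R) (M : nat -> R) n :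
  (forall k, measurable_fun setT (f k)) -> (forall k x, `|f k x| <= M k) ->
  \int[mu]_x (\sum_(k < n) f k x) = \sum_(k < n) \int[mu]_x f k x.
Proof.
move=> mf fM; elim: n => [|n IH].
  rewrite big_ord0 -[RHS](mul0r (fine (mu setT))) -Rintegral_cst//.
  by apply: eq_Rintegral => x _; rewrite big_ord0.
rewrite big_ord_recr/= -IH -RintegralD//.
- by apply: eq_Rintegral => x _; rewrite big_ord_recr.
- apply: (bounded_integrable _ (\sum_(k < n) M k)); last exact: bounded_sum.
  exact: measurable_sum.
- exact: bounded_integrable (fM n).
Qed.

End bounded_integrals.

(** * Total variation control of integrals of bounded functions *)

(** The sum counts the positive integers up to [t], so it is the integer part of [t]. *)
Lemma layer_sum (R : realType) (n : nat) (t : R) : 0 <= t <= n%:R ->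
  `|t - \sum_(k < n) (k.+1%:R <= t)%R%:R| <= 1.
Proof.
elim: n t => [|n IH] t.
  by move=> /andP[t0 tn]; rewrite big_ord0 ler_norml; lra.
move=> /andP[t0 tn]; rewrite big_ord_recr/=; have [tn'|tn'] := leP t n%:R.
  have -> : (n.+1%:R <= t) = false.
    by apply/negbTE; rewrite -ltNge; apply: le_lt_trans tn' _; rewrite ltr_nat.
  by rewrite addr0 IH// t0.
(* Here n < t <= n + 1: the first [n] indicators are all 1 and only the last one is undecided. *)
have -> : \sum_(k < n) ((k.+1%:R <= t)%R%:R : R) = n%:R.
  rewrite (eq_bigr (fun=> 1)) ?sumr_const ?card_ord// => k _.
  by rewrite (_ : _ <= t = true)//; apply: le_trans (ltW tn'); rewrite ler_nat.
move: tn; rewrite -natr1 => tn.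
case: (leP (n%:R + 1) t) => h /=; rewrite ler_norml; lra.
Qed.

Section tv_integral.
Context {d} {T : measurableType d} {R : realType}.
Variables (P Q : {measure set T -> \bar R}).
Hypotheses (P1 : P setT = 1%E) (Q1 : Q setT = 1%E).
Variables (s : R).
Hypothesis (PQs : forall B, measurable B -> `|fine (P B) - fine (Q B)| <= s).

(* [f] is uniformly close to the average of the indicators of its level sets
   [f >= k / n], and each level set contributes at most [s]. *)
Lemma tv_Rintegral01 (f : T -> R) : measurable_fun setT f ->
  (forall x, 0 <= f x <= 1) -> `|\int[P]_x f x - \int[Q]_x f x| <= s.
Proof.
move=> mf f01; have fM x : `|f x| <= 1.
  by have := f01 x; rewrite ler_norml => /andP[? ?]; lra.
apply/ler_addgt0Pr => e e0.
(* The 2 pays for replacing [f] by its layered average twice, once under [P] and once under [Q], at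
   cost 1 / (n + 1) each. *)
have [n n2] : exists n : nat, 2 / e < n.+1%:R.
  exists (Num.trunc (2 / e)); exact: truncnS_gt.
have n0 : 0 < n.+1%:R :> R by [].
pose B (k : nat) := [set x | k.+1%:R / n.+1%:R <= f x].
have mB k : measurable (B k).
  rewrite -[B k]setTI; exact: measurable_fun_le.
pose g x : R := \sum_(k < n.+1) n.+1%:R^-1 * \1_(B k) x.
have gE (mu : {measure set T -> \bar R}) : mu setT = 1%E ->
    \int[mu]_x g x = \sum_(k < n.+1) n.+1%:R^-1 * fine (mu (B k)).
  move=> mu1; have M1 k x : `|n.+1%:R^-1 * \1_(B k) x : R| <= 1.
    rewrite indicE ger0_norm ?mulr_ge0 ?invr_ge0//.
    by rewrite mulr_ile1 ?invr_ge0 ?invf_le1 ?ler1n//; case: (_ \in _).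
  rewrite (Rintegral_sum mu mu1 (fun k x => n.+1%:R^-1 * \1_(B k) x)
    (fun=> 1))//; last first.
    by move=> k; apply: measurable_realfun.measurable_funM.
  apply: eq_bigr => k _; rewrite RintegralZl//; last first.
    apply: (bounded_integrable mu mu1 _ 1) => // x.
    by rewrite indicE; case: (_ \in _); rewrite ?normr1 ?normr0.
  by rewrite /Rintegral integral_indic// setIT.
have mg : measurable_fun setT g.
  apply: measurable_sum => k; apply: measurable_realfun.measurable_funM => //.
have fg x : `|f x - g x| <= n.+1%:R^-1.
  have -> : g x = n.+1%:R^-1 * \sum_(k < n.+1) (k.+1%:R <= n.+1%:R * f x)%R%:R.
    rewrite /g mulr_sumr; apply: eq_bigr => k _; congr (_ * _).
    rewrite indicE; congr (nat_of_bool _)%:R; apply/idP/idP.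
      by move=> /set_mem; rewrite /B/= ler_pdivrMr// mulrC.
    by move=> h; apply/mem_set; rewrite /B/= ler_pdivrMr// mulrC.
  rewrite -[in X in `|X - _|](mulKf (lt0r_neq0 n0) (f x)) -mulrBr normrM.
  rewrite ger0_norm ?invr_ge0// ler_piMr ?invr_ge0//; apply: layer_sum.
  have /andP[f0 f1] := f01 x.
  by rewrite mulr_ge0//= ler_piMr.
have gM x : `|g x| <= 2.
  have : n.+1%:R^-1 <= 1 :> R by rewrite invf_le1// ler1n.
  move: (fg x) (fM x); rewrite !ler_norml.
  by move: (f x) (g x) (_^-1) => a b q; lra.
have ePg : `|\int[P]_x f x - \int[P]_x g x| <= n.+1%:R^-1.
  apply: (Rintegral_dist _ _ _ _ 2) => // x.
  by apply: le_trans (fM x) _; rewrite ler1n.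
have eQg : `|\int[Q]_x f x - \int[Q]_x g x| <= n.+1%:R^-1.
  apply: (Rintegral_dist _ _ _ _ 2) => // x.
  by apply: le_trans (fM x) _; rewrite ler1n.
have ePQ : `|\int[P]_x g x - \int[Q]_x g x| <= s.
  rewrite !gE// -sumrB; apply: le_trans (ler_norm_sum _ _ _) _.
  apply: (@le_trans _ _ (\sum_(k < n.+1) n.+1%:R^-1 * s)).
    apply: ler_sum => k _; rewrite -mulrBr normrM ger0_norm ?invr_ge0//.
    by rewrite ler_wpM2l ?invr_ge0 ?PQs.
  by rewrite sumr_const card_ord -[X in X <= _]mulr_natl mulrA divff ?mul1r.
have : 2 * n.+1%:R^-1 < e.
  by rewrite ltr_pdivrMr// mulrC -ltr_pdivrMr.
move: ePg eQg ePQ; rewrite !ler_norml.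
by move: (_^-1) (Rintegral _ _ f) (Rintegral _ _ f) => q a b; lra.
Qed.

(** The affine map taking [-M, M] onto [0, 1] reduces this to [tv_Rintegral01]; undoing it
    multiplies the bound by 2 * M, the constant part cancelling because both measures have mass
    1. *)
Lemma tv_Rintegral (f : T -> R) M : 0 < M -> measurable_fun setT f ->
  (forall x, `|f x| <= M) -> `|\int[P]_x f x - \int[Q]_x f x| <= 2 * M * s.
Proof.
move=> M0 mf fM; pose h x := (2 * M)^-1 * (f x + M).
have mh : measurable_fun setT h.
  by apply: measurable_realfun.measurable_funM => //;
    apply: measurable_realfun.measurable_funD.
have h01 x : 0 <= h x <= 1.
  rewrite /h ler_pdivrMl ?mulr_gt0// mulr_ge0 ?invr_ge0 ?mulr_ge0 ?(ltW M0)//=.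
    by move: (fM x); rewrite ler_norml; lra.
  by move: (fM x); rewrite ler_norml; lra.
have fE (mu : {measure set T -> \bar R}) : mu setT = 1%E ->
    \int[mu]_x h x = (2 * M)^-1 * (\int[mu]_x f x + M).
  move=> mu1; rewrite RintegralZl//.
    rewrite RintegralD//.
    - by rewrite Rintegral_cst// mu1 mulr1.
    - exact: bounded_integrable fM.
    - exact: (bounded_integrable mu mu1 (cst M) `|M|).
  apply: (bounded_integrable mu mu1 _ (2 * M)).
    exact: measurable_realfun.measurable_funD.
  by move=> x; move: (fM x); rewrite !ler_norml; lra.
have := tv_Rintegral01 h mh h01; rewrite !fE// -mulrBr normrM.
by rewrite gtr0_norm ?invr_gt0 ?mulr_gt0// ler_pdivrMl ?mulr_gt0//
  opprD addrACA subrr addr0.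
Qed.

End tv_integral.

(** * Neighbourhoods, compactness, and continuity of channels *)

Section topology.
Context {R : realType}.

(** If [P] failed arbitrarily close to [x], a counterexample picked in each ball of radius 1 / (n +
    1) would give a sequence tending to [x] that avoids [P]. *)
Lemma near_sequentially (X : pseudoMetricType R) (x : X) (P : X -> Prop) :
  (forall xs : nat -> X, xs n @[n --> \oo] --> x -> exists n, P (xs n)) ->
  \forall y \near x, P y.
Proof.
move=> xsP; apply: contrapT => nP.
have [xs xs_x] : {xs : nat -> X & forall n, ball x n.+1%:R^-1 (xs n) /\ ~ P (xs n)}.
  apply: (@choice nat X (fun n y => ball x n.+1%:R^-1 y /\ ~ P y)) => n.
  apply: contrapT => /forallNP nball.
  apply: nP; apply/nbhs_ballP; exists n.+1%:R^-1 => //= y xy.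
  by apply: contrapT => Py; apply: (nball y).
have [n] : exists n, P (xs n); last by case: (xs_x n).
apply: xsP; apply/cvg_ballP => e e0; near=> n.
have [+ _] := xs_x n; apply: le_ball; near: n.
by apply: filterS (near_infty_natSinv_lt (PosNum e0)) => n /ltW.
Unshelve. all: by end_near. Qed.

(** Tube lemma: continuity at each (x, k) gives a product neighbourhood, and compactness of [K]
    extracts one neighbourhood of [x] valid for all [k]. *)
Lemma near_uniform_compact (X K : topologicalType) (f : X * K -> R)
    (x : X) (e : R) :
  compact [set: K] -> continuous f -> 0 < e ->
  \forall y \near x, forall k, `|f (y, k) - f (x, k)| <= e.
Proof.
move=> /compact_near_coveringP cK cf e0.
suff : \forall y \near x, [set: K] `<=` (fun k => `|f (y, k) - f (x, k)| <= e).
  by apply: filterS => y Hy k; exact: Hy.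
apply: cK => k _.
(* Half of [e], since f (y, k') and f (x, k') are both compared with f (x, k). *)
have e20 : 0 < e / 2 by rewrite divr_gt0.
have /cvgrPdist_le/(_ _ e20)[[U V]/= [xU kV] UV] := cf (x, k).
exists (V, U) => //= -[k' y]/= [Vk Uy].
have h1 := UV (y, k') (conj Uy Vk).
have h2 := UV (x, k') (conj (nbhs_singleton xU) Vk).
by move: h1 h2; rewrite /= !ler_norml; lra.
Qed.

Lemma borel_continuous_measurable {d} {T : topoMeasType R d} (f : T -> R) :
  polish_borel T -> continuous f -> measurable_fun setT f.
Proof.
move=> [_ _ mT] /continuousP cf.
apply: (measurability _ (measurable_realfun.RGenOpens.measurableE R)).
move=> _ [_ [a [b ->] <-]]; rewrite setTI; apply/mT.
by apply: sub_sigma_algebra; apply: cf; exact: interval_open.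
Qed.

(** Turns sequential continuity into a neighbourhood of [x] that serves all events [B] at once, the
    form in which it combines with [near_uniform_compact]. *)
Lemma tv_continuous_near dX dY (X : topoMeasType R dX) (Y : measurableType dY)
    (Q : R.-pker X ~> Y) (x : X) (e : R) : tv_continuous Q -> 0 < e ->
  \forall y \near x,
    forall B, measurable B -> `|fine (Q y B) - fine (Q x B)| <= e.
Proof.
move=> Qtv e0; apply: near_sequentially => xs /Qtv/fine_cvgP[+ tv0].
move/cvgrPdist_le : tv0 => /(_ _ e0) tve tvfin.
have [n [nfin ne]] : exists n, tv_dist (Q (xs n)) (Q x) \is a fin_num /\
    `|0 - fine (tv_dist (Q (xs n)) (Q x))| <= e.
  apply: (@filter_ex _ \oo); near=> n; split.
    by near: n.
  by near: n.
exists n => B mB; rewrite -lee_fin.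
have finQ z : Q z B \is a fin_num.
  exact: finite_kernel_measure.
rewrite -fineB// -fine_abse ?fin_numB ?finQ// fineK; last first.
  by rewrite abse_fin_num fin_numB !finQ.
set S := [set `|Q (xs n) B - Q x B|%E | B in [set B : set Y | measurable B]].
have SB : (`|Q (xs n) B - Q x B| <= ereal_sup S)%E.
  by apply: ereal_sup_ubound; exists B.
apply: (@le_trans _ _ (tv_dist (Q (xs n)) (Q x))).
  (* The supremum is nonnegative, so the factor 2 in [tv_dist] only enlarges it. *)
  have S0 : (0 <= ereal_sup S)%E by apply: le_trans SB; exact: abse_ge0.
  apply: le_trans SB _; rewrite /tv_dist -/S.
  by rewrite -[leLHS]mul1e lee_wpmul2r// lee_fin ler1n.
rewrite -(fineK nfin) lee_fin; apply: le_trans ne.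
by rewrite sub0r normrN ler_norm.
Unshelve. all: by end_near. Qed.

End topology.

(* Ranga Rao's theorem: the [h k] are bumps supported where the family
   oscillates by less than [e], and [residue n = \prod_(k < n) (1 - h k)]
   is what the partition of unity [h k * residue k], [k < n], misses. *)
Section bumps.
Context {R : realType} {dX : measure_display} {X : topoMeasType R dX}.
Variable F : set (X -> R).

Definition residue (h : nat -> X -> R) (n : nat) (x : X) : R :=
  \prod_(k < n) (1 - h k x).

Lemma residueS (h : nat -> X -> R) n x :
  residue h n.+1 x = residue h n x - h n x * residue h n x.
Proof. by rewrite /residue big_ord_recr/= mulrBr mulr1 mulrC. Qed.

(** Telescoping: by [residueS] each term is the drop from [residue h k] to [residue h k.+1]. *)
Lemma residue_sum (h : nat -> X -> R) n x :
  \sum_(k < n) h k x * residue h k x = 1 - residue h n x.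
Proof.
elim: n => [|n IH]; first by rewrite /residue !big_ord0 subrr.
by rewrite big_ord_recr/= IH residueS opprB addrA addrAC.
Qed.

Lemma residue_itv (h : nat -> X -> R) n x :
  (forall k, 0 <= h k x <= 1) -> 0 <= residue h n x <= 1.
Proof.
move=> h01; elim: n => [|n /andP[r0 r1]];
  first by rewrite /residue big_ord0 ler01 lexx.
have /andP[h0 h1] := h01 n.
rewrite residueS -{1 3}[residue h n x]mul1r -mulrBl mulr_ge0 ?subr_ge0//=.
by rewrite mulr_ile1 ?subr_ge0// lerBlDr lerDl.
Qed.

Lemma residue_eq0 (h : nat -> X -> R) k n x :
  h k x = 1 -> (k < n)%N -> residue h n x = 0.
Proof.
move=> hk kn; rewrite /residue (bigD1 (Ordinal kn))//= hk subrr mul0r//.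
Qed.

Lemma residue_continuous (h : nat -> X -> R) n :
  (forall k, continuous (h k)) -> continuous (residue h n).
Proof.
move=> ch x; apply: cvg_big.
  exact: mul_continuous.
by move=> k _; apply: cvgB; [exact: cvg_cst|exact: ch].
Qed.

Definition equicontinuous_at (x : X) :=
  forall e : R, 0 < e -> \forall y \near x, forall f, F f -> `|f y - f x| <= e.

(** Bumps sit on balls with centre in a countable dense set and radius 1 / (n + 1), kept only where
    [F] oscillates little. Equicontinuity puts every point in the inner half of such a ball. *)
Lemma exists_bumps (e : R) : polish_borel X -> 0 < e ->
  (forall x, equicontinuous_at x) ->
  exists (h : nat -> X -> R) (p : nat -> X),
    [/\ forall k, continuous (h k), forall k x, 0 <= h k x <= 1,
      forall k x, h k x != 0 -> forall f, F f -> `|f x - f (p k)| <= e &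
      forall x, exists k, h k x = 1].
Proof.
move=> [_ [D [/pcard_surjP[p pD]] dD] _] e0 eqF.
pose d (kn : nat * nat) := p kn.1.
pose r (kn : nat * nat) : R := kn.2.+1%:R^-1.
pose small kn := forall y, ball (d kn) (r kn) y ->
  forall f, F f -> `|f y - f (d kn)| <= e.
have bump (kn : nat * nat) : exists h : X -> R, [/\ continuous h,
    forall x, 0 <= h x <= 1, forall x, h x != 0 -> small kn /\ ball (d kn) (r kn) x &
    small kn -> forall x, ball (d kn) (r kn / 2) x -> h x = 1].
  have [sm|nsm] := pselect (small kn); last first.
    (* A ball that is not [small] gets the zero bump, for which the oscillation condition is
       vacuous. *)
    exists (cst 0); split => //; first by move=> x; exact: cvg_cst.
    + by move=> x; rewrite lexx ler01.
    + by move=> x /eqP.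
  have r2 : 0 < r kn / 2 by rewrite divr_gt0// invr_gt0.
  have /(@uniform_separatorP X R)[h [ch h01 h0 h1]] :
      uniform_separator (~` ball (d kn) (r kn)) (ball (d kn) (r kn / 2)).
    (* The inner half-ball and the complement of the ball are at distance at least r / 2. *)
    apply: uniform_separatorW.
    exists [set xy | ball xy.1 (r kn / 2) xy.2].
      exact: (entourage_ball X (PosNum r2)).
    rewrite -subset0 => -[x y] [[/= nx /ball_sym xy'] xy]; apply: nx.
    apply: (@ball_sym _ _ x); rewrite [r kn]splitr.
    exact: ball_triangle xy xy'.
  exists h; split => //.
  - by move=> x; have := h01 (h x) (ex_intro2 _ _ x I erefl); rewrite /= in_itv.
  - move=> x /eqP hx; split=> //; apply: contrapT => nx; apply: hx.
    by apply: h0; exists x.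
  - by move=> _ x bx; apply: h1; exists x.
have [h hP] := choice bump.
(* Pairs (centre, radius) are coded by one index; an index that decodes to no pair repeats the bump
   of (0, 0), which is harmless. *)
exists (fun k => h (odflt (0, 0)%N (unpickle k))),
  (fun k => d (odflt (0, 0)%N (unpickle k))).
split=> [k|k x|k x|x].
- by have [] := hP (odflt (0, 0)%N (unpickle k)).
- by have [] := hP (odflt (0, 0)%N (unpickle k)).
- by have [_ _ + _] := hP (odflt (0, 0)%N (unpickle k)) => /[apply] -[]; exact.
(* Values on the chosen ball are compared with its centre through [x], hence e / 2. Its centre lies
   within half a radius of [x], so a radius below s / 2 keeps the whole ball within [s] of [x]. *)
have e20 : 0 < e / 2 by rewrite divr_gt0.
have /nbhs_ballP[s /= s0 xs] := eqF x _ e20.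
have [n ns] : exists n : nat, n.+1%:R^-1 < s / 2.
  have s20 : 0 < s / 2 by rewrite divr_gt0.
  exists (Num.trunc (s / 2)^-1); rewrite invf_plt ?posrE//.
  exact: truncnS_gt.
have n0 : 0 < n.+1%:R^-1 / 2 :> R by rewrite divr_gt0// invr_gt0.
have [y [/interior_subset xy Dy]] : (ball x (n.+1%:R^-1 / 2))° `&` D !=set0.
  apply: dD; last exact: open_interior.
  by exists x; apply: nbhsx_ballx.
have [i _ py] := pD y Dy.
exists (pickle (i, n)); rewrite pickleK /=.
have [_ _ _] := hP (i, n); apply; last by rewrite /d /r/= py; exact: ball_sym.
move=> z; rewrite /d /r /= py => yz f Ff.
have ball_le_s (t : R) w : t <= s -> ball x t w -> ball x s w by move=> /le_ball; apply.
have xz : `|f z - f x| <= e / 2.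
  apply: xs Ff; apply: (ball_le_s (n.+1%:R^-1 / 2 + n.+1%:R^-1)).
    by move: ns; move: (n.+1%:R^-1) n0 => q; lra.
  exact: ball_triangle xy yz.
have xy' : `|f y - f x| <= e / 2.
  apply: xs Ff; apply: ball_le_s xy.
  by move: ns; move: (n.+1%:R^-1) n0 => q; lra.
by move: xz xy'; rewrite !ler_norml; lra.
Qed.

End bumps.

(** * Uniformity of weak convergence over bounded equicontinuous families *)

Section ranga_rao.
Context {R : realType} {dX : measure_display} {X : topoMeasType R dX}.
Hypothesis hX : polish_borel X.
Variables (zs : nat -> probability X R) (z : probability X R).
Hypothesis zsz : weak_cvg zs z.

Lemma weak_cvg_Rintegral (f : X -> R) M : continuous f ->
  (forall x, `|f x| <= M) ->
  \int[zs n]_x f x @[n --> \oo] --> \int[z]_x f x.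
Proof.
move=> cf fM; have mf := borel_continuous_measurable f hX cf.
have /(_ (ex_intro _ M fM)) := zsz f cf.
rewrite (EFin_Rintegral z (probability_setT z) f M)//.
under eq_fun do rewrite (EFin_Rintegral _ (probability_setT _) f M)//.
by move=> /fine_cvgP[_].
Qed.

Variables (F : set (X -> R)) (M : R).
Hypothesis FM : forall f, F f -> forall x, `|f x| <= M.
Hypothesis eqF : forall x, equicontinuous_at F x.

Lemma equicontinuous_continuous (f : X -> R) : F f -> continuous f.
Proof.
move=> Ff x; apply/cvgrPdist_le => e e0.
by apply: filterS (eqF x e e0) => y /(_ _ Ff); rewrite distrC.
Qed.

(* On the part of the space covered by the first [n] bumps, [f] is within [e]
   of a combination of [n] functions that do not depend on [f]. *)
Lemma bump_approx (h : nat -> X -> R) (p : nat -> X) (e : R) n f x : 0 <= e ->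
  (forall k x, 0 <= h k x <= 1) ->
  (forall k x, h k x != 0 -> forall f, F f -> `|f x - f (p k)| <= e) -> F f ->
  `|f x - \sum_(k < n) f (p k) * (h k x * residue h k x)|
    <= e + M * residue h n x.
Proof.
move=> e0 h01 hF Ff.
have -> : f x - \sum_(k < n) f (p k) * (h k x * residue h k x) =
    \sum_(k < n) (f x - f (p k)) * (h k x * residue h k x) + f x * residue h n x.
  under [in RHS]eq_bigr do rewrite mulrBl.
  rewrite sumrB -mulr_sumr residue_sum; ring.
apply: le_trans (ler_normD _ _) _; apply: lerD; last first.
  rewrite normrM (ger0_norm (proj1 (andP (residue_itv h n x (h01^~ x))))).
  by rewrite ler_wpM2r ?FM//; have /andP[] := residue_itv h n x (h01^~ x).
apply: le_trans (ler_norm_sum _ _ _) _.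
apply: (@le_trans _ _ (\sum_(k < n) e * (h k x * residue h k x))).
  apply: ler_sum => k _.
  have w0 : 0 <= h k x * residue h k x.
    have /andP[h0 _] := h01 k x.
    by rewrite mulr_ge0//; have /andP[] := residue_itv h k x (h01^~ x).
  rewrite normrM (ger0_norm w0).
  have [->|hk] := eqVneq (h k x) 0; first by rewrite mul0r !mulr0.
  by rewrite ler_wpM2r// hF.
rewrite -mulr_sumr residue_sum ler_piMr// lerBlDr lerDl.
by have /andP[] := residue_itv h n x (h01^~ x).
Qed.

(** At each point some bump equals 1, so the residue is eventually 0 there; dominated convergence
    with bound 1 concludes. *)
Lemma residue_Rintegral_cvg0 (h : nat -> X -> R) :
  (forall k, continuous (h k)) -> (forall k x, 0 <= h k x <= 1) ->
  (forall x, exists k, h k x = 1) ->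
  \int[z]_x residue h n x @[n --> \oo] --> 0.
Proof.
move=> ch h01 h1.
have rM n x : `|residue h n x| <= 1.
  by have /andP[r0 r1] := residue_itv h n x (h01^~ x); rewrite ger0_norm.
have mr n : measurable_fun setT (residue h n).
  by apply: borel_continuous_measurable => //; exact: residue_continuous.
have [|||||_ _] := @dominated_convergence _ _ _ z setT measurableT
  (fun n x => (residue h n x)%:E) (cst 0%E) (cst 1%E).
- by move=> n; apply/measurable_realfun.measurable_EFinP.
- exact: measurable_cst.
- apply: aeW => x _; have [k hk] := h1 x.
  apply: cvg_near_cst; near=> n; rewrite (residue_eq0 h k)//.
  by near: n; exact: nbhs_infty_gt.
- by apply: (bounded_integrable z (probability_setT z) (cst 1) 1) => // x; rewrite normr1.
- by apply: aeW => x n _; rewrite lee_fin.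
rewrite integral0 => /fine_cvgP[_]; apply.
Unshelve. all: by end_near. Qed.

(** Integrating [bump_approx] separates [f], present only through the values f (p k), from [mu],
    present only through integrals of functions independent of [f]. *)
Lemma bump_approx_Rintegral (mu : {measure set X -> \bar R}) (h : nat -> X -> R)
    (p : nat -> X) (e : R) n f : mu setT = 1%E -> 0 <= e ->
  (forall k, continuous (h k)) -> (forall k x, 0 <= h k x <= 1) ->
  (forall k x, h k x != 0 -> forall f, F f -> `|f x - f (p k)| <= e) -> F f ->
  `|\int[mu]_x f x
    - \sum_(k < n) f (p k) * \int[mu]_x (h k x * residue h k x)|
    <= e + M * \int[mu]_x residue h n x.
Proof.
move=> mu1 e0 ch h01 hF Ff.
have rM k x : `|residue h k x| <= 1.
  by have /andP[r0 r1] := residue_itv h k x (h01^~ x); rewrite ger0_norm.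
have mr k : measurable_fun setT (residue h k).
  by apply: borel_continuous_measurable => //; exact: residue_continuous.
have mh k : measurable_fun setT (h k) by exact: borel_continuous_measurable.
have mw k : measurable_fun setT (fun x => h k x * residue h k x).
  exact: measurable_realfun.measurable_funM.
have w1 k x : `|h k x * residue h k x| <= 1.
  have /andP[h0 h1] := h01 k x.
  by rewrite normrM (ger0_norm h0) mulr_ile1.
have mf : measurable_fun setT f.
  by apply: borel_continuous_measurable => //; exact: equicontinuous_continuous.
have cw1 k x : `|f (p k) * (h k x * residue h k x)| <= `|f (p k)|.
  by rewrite normrM ler_piMr.
have mcw k : measurable_fun setT (fun x => f (p k) * (h k x * residue h k x)).
  exact: measurable_realfun.measurable_funM.
under eq_bigr => k _ do
  rewrite -(RintegralZl _ _ (bounded_integrable mu mu1 _ 1 (mw k) (w1 k)))//.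
rewrite -(Rintegral_sum mu mu1 (fun k x => f (p k) * (h k x * residue h k x))
  (fun k => `|f (p k)|))//.
have intf := bounded_integrable mu mu1 f M mf (FM f Ff).
have mS : measurable_fun setT
    (fun x => \sum_(k < n) f (p k) * (h k x * residue h k x)).
  exact: measurable_sum.
have intS := bounded_integrable mu mu1 _ _ mS (bounded_sum _ _ n cw1).
have intD := integrableB measurableT intf intS.
rewrite -RintegralB//; apply: le_trans (le_normr_Rintegral _ intD) _ => //.
have intr := bounded_integrable mu mu1 _ 1 (mr n) (rM n).
have intc := bounded_integrable mu mu1 (cst e) `|e| (measurable_cst _) (fun=> lexx _).
have intMr : mu.-integrable setT (EFin \o (fun x => M * residue h n x)).
  exact: (integrableZl measurableT M intr).
have -> : e + M * \int[mu]_x residue h n x = \int[mu]_x (e + M * residue h n x).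
  by rewrite (RintegralD _ intc intMr)// Rintegral_cst// RintegralZl// mu1 mulr1.
apply: le_Rintegral => //.
- exact: integrable_norm intD.
- exact: (integrableD measurableT intc intMr).
- by move=> x _; exact: (bump_approx h p e n f x e0 h01 hF Ff).
Qed.

(** Weak convergence is applied only to finitely many functions, the first [N] weights and the
    residue at [N]; none depends on [f], which gives uniformity. *)
Lemma weak_cvg_equicontinuous (e : R) : 0 < e ->
  \forall n \near \oo, forall f, F f ->
    `|\int[zs n]_x f x - \int[z]_x f x| <= e.
Proof.
(* Error budget in units of e / 8: two for approximating under [z], three under [zs n], one for
   comparing the combinations. *)
move=> e0; have e80 : 0 < e / 8 by rewrite divr_gt0.
have [h [p [ch h01 hF h1]]] := exists_bumps F _ hX e80 eqF.
(* [M] may vanish; [K] is a positive bound by which one can divide. *)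
pose K := `|M| + 1; have K0 : 0 < K by rewrite /K ltr_wpDl.
have MK : M <= K by rewrite /K (le_trans (ler_norm M))// lerDl.
have eK0 : 0 < e / 8 / K by rewrite divr_gt0.
have r01 k x : 0 <= residue h k x <= 1 by exact: residue_itv.
have rM k x : `|residue h k x| <= 1.
  by have /andP[r0 r1] := r01 k x; rewrite ger0_norm.
have [N] : exists N, `|0 - \int[z]_x residue h N x| <= e / 8 / K.
  apply: (@filter_ex _ \oo).
  by move/cvgrPdist_le : (residue_Rintegral_cvg0 h ch h01 h1); apply.
rewrite sub0r normrN => zN.
pose w k x := h k x * residue h k x.
have cw k : continuous (w k).
  by move=> x; apply: cvgM; [exact: ch|exact: residue_continuous].
have w1 k x : `|w k x| <= 1.
  by have /andP[h0 h1'] := h01 k x; rewrite normrM (ger0_norm h0) mulr_ile1.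
have : \sum_(k < N) `|\int[zs n]_x w k x - \int[z]_x w k x| @[n --> \oo]
    --> \sum_(k < N) (0 : R).
  apply: cvg_big; first exact: add_continuous.
  move=> k _; apply/cvgrPdist_le => d d0.
  have /cvgrPdist_le/(_ _ d0) := weak_cvg_Rintegral _ _ (cw k) (w1 k).
  by apply: filterS => n; rewrite sub0r normrN normr_id distrC.
rewrite big1// => /cvgrPdist_le/(_ _ eK0) wN.
have /cvgrPdist_le/(_ _ eK0) zsN :=
  weak_cvg_Rintegral _ _ (residue_continuous h N ch) (rM N).
near=> n => f Ff.
have fz (mu : probability X R) := bump_approx_Rintegral mu h p _ N f
  (probability_setT mu) (ltW e80) ch h01 hF Ff.
have := fz z; have := fz (zs n).
set SA := \sum_(k < N) f (p k) * _; set SB := \sum_(k < N) f (p k) * _.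
have rge0 (mu : probability X R) : 0 <= \int[mu]_x residue h N x.
  by apply: Rintegral_ge0 => x _; have /andP[] := r01 N x.
(* The coefficients f (p k) are bounded by [K], so the gap is at most [K] times the total change of
   the integrated weights. *)
have SAB : `|SA - SB| <= e / 8.
  have : `|0 - \sum_(k < N) `|\int[zs n]_x w k x - \int[z]_x w k x| | <= e / 8 / K.
    by near: n.
  rewrite sub0r normrN ger0_norm ?sumr_ge0// ler_pdivlMr// mulrC.
  apply: le_trans; rewrite /SA /SB -sumrB mulr_sumr.
  apply: le_trans (ler_norm_sum _ _ _) _; apply: ler_sum => k _.
  by rewrite -mulrBr normrM ler_wpM2r// (le_trans _ MK)// FM.
have Mr (mu : probability X R) (q : R) :
    \int[mu]_x residue h N x <= q / K -> M * \int[mu]_x residue h N x <= q.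
  by move=> rq; apply: le_trans (ler_wpM2r (rge0 mu) MK) _; rewrite mulrC -ler_pdivlMr.
have Mz : M * \int[z]_x residue h N x <= e / 8.
  by apply: Mr; apply: le_trans zN; exact: ler_norm.
(* The residue integral under [zs n] is the one under [z] plus the weak convergence error, each at
   most e / 8 / K. *)
have Mzs : M * \int[zs n]_x residue h N x <= e / 8 + e / 8.
  apply: Mr; rewrite mulrDl -lerBlDl.
  apply: (@le_trans _ _ (\int[zs n]_x residue h N x - \int[z]_x residue h N x)).
    by rewrite lerD2l lerN2 (le_trans (ler_norm _) zN).
  apply: le_trans (ler_norm _) _; rewrite distrC.
  by near: n.
move: Mz Mzs SAB; rewrite !ler_norml.
move: (M * _) (M * _) (Rintegral _ _ f) (Rintegral _ _ f) => ma mb fa fb; lra.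
Unshelve. all: by end_near. Qed.

End ranga_rao.

(** * Equicontinuity of the conditional costs *)

(** Pass through the integral of [f] under [P']: first the integrand changes, then the measure. *)
Lemma Rintegral_perturb {d} {T : measurableType d} {R : realType}
    (P P' : {measure set T -> \bar R}) (s a M : R) (f f' : T -> R) :
  P setT = 1%E -> P' setT = 1%E -> 0 < M ->
  (forall B, measurable B -> `|fine (P' B) - fine (P B)| <= s) ->
  measurable_fun setT f -> measurable_fun setT f' ->
  (forall x, `|f x| <= M) -> (forall x, `|f' x| <= M) ->
  (forall x, `|f' x - f x| <= a) ->
  `|\int[P']_x f' x - \int[P]_x f x| <= a + 2 * M * s.
Proof.
move=> P1 P'1 M0 PPs mf mf' fM f'M ffa.
rewrite (le_trans (ler_distD (\int[P']_x f x) _ _))// lerD//.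
- exact: (Rintegral_dist P' P'1 f' f M).
- exact: tv_Rintegral.
Qed.

Lemma continuous_pair {T A B : topologicalType} (f : T -> A) (g : T -> B) :
  continuous f -> continuous g -> continuous (fun x => (f x, g x)).
Proof.
move=> cf cg x.
exact: (@cvg_pair _ _ _ (nbhs x) (nbhs (f x)) (nbhs (g x)) _ _ _ f g (cf x) (cg x)).
Qed.

Section conditional_cost.
Context {R : realType} {dX dY1 dY2 dU1 dU2 : measure_display}.
Context {X : topoMeasType R dX} {Y1 : topoMeasType R dY1} {Y2 : topoMeasType R dY2}.
Context {U1 : topoMeasType R dU1} {U2 : topoMeasType R dU2}.
Hypotheses (hX : polish_borel X) (hU1 : polish_borel U1) (hU2 : polish_borel U2).
Variable c : (X * U1 * U2)%type -> R.
Hypothesis c_cont : continuous c.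
Variable M : R.
Hypotheses (M0 : 0 < M) (cM : forall z, `|c z| <= M).
Hypotheses (U1_cpt : compact [set: U1]) (U2_cpt : compact [set: U2]).
Variables (Q1 : R.-pker X ~> Y1) (Q2 : R.-pker X ~> Y2).
Hypotheses (Q1_tv : tv_continuous Q1) (Q2_tv : tv_continuous Q2).

(** Taken as a function of the action [u] rather than of the observation, so that continuity in [u]
    yields measurability after composing with [g1]. *)
Definition cost_y1 (g2 : Y2 -> U2) (x : X) (u : U1) : R :=
  \int[Q2 x]_y c (x, u, g2 y).

Definition cost_x (g1 : Y1 -> U1) (g2 : Y2 -> U2) (x : X) : R :=
  \int[Q1 x]_y cost_y1 g2 x (g1 y).

Lemma measurable_cost (g2 : Y2 -> U2) x u : measurable_fun setT g2 ->
  measurable_fun setT (fun y => c (x, u, g2 y)).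
Proof.
move=> mg2; apply: (measurableT_comp (f := fun v => c (x, u, v))) => //.
apply: borel_continuous_measurable => // v.
apply: (@continuous_comp _ _ _ (fun v => (x, u, v)) c v); last exact: c_cont.
by apply: continuous_pair => w; [exact: cvg_cst|exact: cvg_id].
Qed.

Lemma cost_y1_bound g2 x u : measurable_fun setT g2 -> `|cost_y1 g2 x u| <= M.
Proof.
move=> mg2; apply: Rintegral_bound => //; first exact: prob_kernel.
exact: measurable_cost.
Qed.

(** Compactness of [U2] makes the cost vary little with [u] uniformly in the other action, hence
    along any measurable [g2]. *)
Lemma cost_y1_continuous g2 x : measurable_fun setT g2 -> continuous (cost_y1 g2 x).
Proof.
move=> mg2 u; apply/cvgrPdist_le => e e0.
have cc : continuous (fun uv : U1 * U2 => c (x, uv.1, uv.2)).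
  move=> uv; apply: (@continuous_comp _ _ _ (fun uv : U1 * U2 => (x, uv.1, uv.2)) c uv);
    last exact: c_cont.
  apply: continuous_pair => w; last exact: cvg_snd.
  by apply: continuous_pair => {}w; [exact: cvg_cst|exact: cvg_fst].
apply: filterS (near_uniform_compact _ _ _ u e U2_cpt cc e0) => u' uu'.
rewrite distrC; apply: (Rintegral_dist _ (prob_kernel x) _ _ M) => //.
- exact: measurable_cost.
- exact: measurable_cost.
- by move=> y; exact: (uu' (g2 y)).
Qed.

Lemma measurable_cost_y1 g1 g2 x : measurable_fun setT g1 -> measurable_fun setT g2 ->
  measurable_fun setT (fun y : Y1 => cost_y1 g2 x (g1 y)).
Proof.
move=> mg1 mg2; apply: (measurableT_comp (f := cost_y1 g2 x)) => //.
by apply: borel_continuous_measurable => //; exact: cost_y1_continuous.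
Qed.

Lemma cost_x_bound g1 g2 x : measurable_fun setT g1 -> measurable_fun setT g2 ->
  `|cost_x g1 g2 x| <= M.
Proof.
move=> mg1 mg2; apply: Rintegral_bound => //; first exact: prob_kernel.
- exact: measurable_cost_y1.
- by move=> y; exact: cost_y1_bound.
Qed.

Definition cost_family : set (X -> R) :=
  [set f | exists g1 g2, [/\ measurable_fun setT g1, measurable_fun setT g2 &
    f = cost_x g1 g2]].

(** Moving [x] perturbs the cost, [Q2] in the inner integral and [Q1] in the outer one, each for e /
    3; the three neighbourhoods are chosen before the policies. *)
Lemma cost_family_equicontinuous x : equicontinuous_at cost_family x.
Proof.
move=> e e0; have e30 : 0 < e / 3 by rewrite divr_gt0.
(* Makes the total variation term 2 * M * s of [Rintegral_perturb] equal to e / 3. *)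
pose s := e / 3 / (2 * M); have s0 : 0 < s by rewrite !divr_gt0 ?mulr_gt0.
have sE : 2 * M * s = e / 3 by rewrite /s mulrC divfK// gt_eqF// mulr_gt0.
have cc : continuous (fun z : X * (U1 * U2) => c (z.1, z.2.1, z.2.2)).
  move=> z.
  apply: (@continuous_comp _ _ _ (fun z : X * (U1 * U2) => (z.1, z.2.1, z.2.2)) c z).
    apply: continuous_pair; first apply: continuous_pair.
    - by move=> w; exact: cvg_fst.
    - by move=> w; apply: (@continuous_comp _ _ _ snd fst w);
        [exact: cvg_snd|exact: cvg_fst].
    - by move=> w; apply: (@continuous_comp _ _ _ snd snd w); exact: cvg_snd.
  exact: c_cont.
have UU : compact [set: U1 * U2] by rewrite -setXTT; exact: compact_setX.
near=> y => _ [g1 [g2 [mg1 mg2 ->]]].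
have cyx : forall k : U1 * U2, `|c (y, k.1, k.2) - c (x, k.1, k.2)| <= e / 3.
  by near: y; exact: (near_uniform_compact _ _ _ x _ UU cc e30).
have Q1s : forall B, measurable B -> `|fine (Q1 y B) - fine (Q1 x B)| <= s.
  by near: y; exact: tv_continuous_near.
have Q2s : forall B, measurable B -> `|fine (Q2 y B) - fine (Q2 x B)| <= s.
  by near: y; exact: tv_continuous_near.
have c1 u : `|cost_y1 g2 y u - cost_y1 g2 x u| <= e / 3 + e / 3.
  rewrite -{2}sE; apply: Rintegral_perturb => //; try exact: prob_kernel.
  - exact: measurable_cost.
  - exact: measurable_cost.
  - by move=> v; exact: (cyx (u, g2 v)).
have -> : e = (e / 3 + e / 3) + e / 3 by lra.
rewrite -{3}sE; apply: Rintegral_perturb => //; try exact: prob_kernel.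
- exact: measurable_cost_y1.
- exact: measurable_cost_y1.
- by move=> v; exact: cost_y1_bound.
- by move=> v; exact: cost_y1_bound.
Unshelve. all: by end_near. Qed.

(** Each layer integrates a bounded measurable function; for the outermost one, measurability
    follows from the continuity given by equicontinuity. *)
Lemma JcostE (z : probability X R) g1 g2 :
  measurable_fun setT g1 -> measurable_fun setT g2 ->
  Jcost c Q1 Q2 z g1 g2 = (\int[z]_x cost_x g1 g2 x)%:E.
Proof.
move=> mg1 mg2; rewrite /Jcost.
have Fc : cost_family (cost_x g1 g2) by exists g1, g2.
rewrite -(EFin_Rintegral z (probability_setT z) _ M); last first.
- by move=> x; exact: cost_x_bound.
- apply: borel_continuous_measurable => //.
  exact: (equicontinuous_continuous _ cost_family_equicontinuous).
apply: eq_integral => x _.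
rewrite -(EFin_Rintegral (Q1 x) (prob_kernel x) _ M); last first.
- by move=> y; exact: cost_y1_bound.
- exact: measurable_cost_y1.
apply: eq_integral => y1 _.
rewrite -(EFin_Rintegral (Q2 x) (prob_kernel x) _ M)//.
exact: measurable_cost.
Qed.

Lemma Jcost_uniform_cvg (zs : nat -> probability X R) (z : probability X R) (e : R) :
  weak_cvg zs z -> 0 < e ->
  \forall n \near \oo, forall g1 g2,
    measurable_fun setT g1 -> measurable_fun setT g2 ->
    `|fine (Jcost c Q1 Q2 (zs n) g1 g2) - fine (Jcost c Q1 Q2 z g1 g2)| <= e.
Proof.
move=> zsz e0.
have FM f : cost_family f -> forall x, `|f x| <= M.
  by move=> [g1 [g2 [mg1 mg2 ->]]] x; exact: cost_x_bound.
have := weak_cvg_equicontinuous hX zs z zsz cost_family M FM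
  cost_family_equicontinuous e e0.
apply: filterS => n Fn g1 g2 mg1 mg2; rewrite !JcostE//=.
by apply: Fn; exists g1, g2.
Qed.

End conditional_cost.

(* The payoff is kept abstract here: the unifier must not unfold [Jcost]. *)
Section saddle_value.
Context {R : realType} {A B : Type} (SA : set A) (SB : set B).
Implicit Types J : A -> B -> \bar R.

(** With the measurable policies as [SA] and [SB], this unfolds to [saddle_point]. *)
Definition is_saddle J a b := [/\ SA a, SB b,
  ereal_inf [set J x b | x in SA] = J a b &
  J a b = ereal_sup [set J a y | y in SB]].

Lemma saddle_le J a b : (forall x y, SA x -> SB y -> J x y \is a fin_num) ->
  is_saddle J a b ->
  (forall x, SA x -> fine (J a b) <= fine (J x b)) /\
  (forall y, SB y -> fine (J a y) <= fine (J a b)).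
Proof.
move=> Jfin [Aa Bb Jinf Jsup]; split=> [x Ax|y By].
- by apply: fine_le; rewrite ?Jfin// -Jinf; apply: ereal_inf_lbound; exists x.
- by apply: fine_le; rewrite ?Jfin// Jsup; apply: ereal_sup_ubound; exists y.
Qed.

Lemma saddle_value_cvg (Js : nat -> A -> B -> \bar R) J
    (xs : nat -> A) (ys : nat -> B) x y :
  (forall n a b, SA a -> SB b -> Js n a b \is a fin_num) ->
  (forall a b, SA a -> SB b -> J a b \is a fin_num) ->
  (forall e : R, 0 < e -> \forall n \near \oo, forall a b, SA a -> SB b ->
    `|fine (Js n a b) - fine (J a b)| <= e) ->
  is_saddle J x y -> (forall n, is_saddle (Js n) (xs n) (ys n)) ->
  Js n (xs n) (ys n) @[n --> \oo] --> J x y.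
Proof.
move=> Jsfin Jfin JsJ sad sads.
have [Ax By _ _] := sad; rewrite -[J x y]fineK ?Jfin//.
apply: cvg_EFin; first by apply: nearW => n; have [? ? _ _] := sads n; exact: Jsfin.
apply/cvgrPdist_le => e e0; apply: filterS (JsJ e e0) => n Jn /=.
have [Axn Byn _ _] := sads n.
have [x_opt y_opt] := saddle_le J x y Jfin sad.
have [xn_opt yn_opt] := saddle_le (Js n) (xs n) (ys n) (Jsfin n) (sads n).
(* Up to [e] at each change of payoff: J x y <= J xn y ~ Jn xn y <= Jn xn yn, and Jn xn yn <= Jn x
   yn ~ J x yn <= J x y, where Jn, xn, yn stand for [Js n], [xs n], [ys n]. *)
move: (Jn _ _ Axn By) (Jn _ _ Ax Byn).
move: (x_opt _ Axn) (y_opt _ Byn) (xn_opt _ Ax) (yn_opt _ By).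
by rewrite !ler_norml; lra.
Qed.

End saddle_value.

Theorem theorem3p4 (R : realType) (dX dY1 dY2 dU1 dU2 : measure_display)
    (X : topoMeasType R dX) (Y1 : topoMeasType R dY1) (Y2 : topoMeasType R dY2)
    (U1 : topoMeasType R dU1) (U2 : topoMeasType R dU2)
    (hX : polish_borel X) (hY1 : polish_borel Y1) (hY2 : polish_borel Y2)
    (hU1 : polish_borel U1) (hU2 : polish_borel U2)
    (c : (X * U1 * U2)%type -> R)
    (* A2: continuous and bounded cost *)
    (c_cont : continuous c) (c_bnd : exists M : R, forall z, `|c z| <= M)
    (* A4: compact action spaces *)
    (U1_cpt : compact [set: U1]) (U2_cpt : compact [set: U2])
    (* A6: fixed, conditionally independent channels, continuous in TV *)
    (Q1 : R.-pker X ~> Y1) (Q2 : R.-pker X ~> Y2)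
    (Q1_tv : tv_continuous Q1) (Q2_tv : tv_continuous Q2)
    (* priors *)
    (zeta : probability X R) (zetas : nat -> probability X R)
    (zeta_cvg : weak_cvg zetas zeta)
    (* saddle points under mu_zeta and each mu_{zeta_m} *)
    (g1 : Y1 -> U1) (g2 : Y2 -> U2)
    (g_saddle : saddle_point c Q1 Q2 zeta g1 g2)
    (g1s : nat -> Y1 -> U1) (g2s : nat -> Y2 -> U2)
    (gs_saddle : forall m, saddle_point c Q1 Q2 (zetas m) (g1s m) (g2s m)) :
  Jcost c Q1 Q2 (zetas m) (g1s m) (g2s m) @[m --> \oo] -->
    Jcost c Q1 Q2 zeta g1 g2.
Proof.
(* A strictly positive bound is required because [s] above is obtained by dividing by 2 * M. *)
have [M M0 cM] : exists2 M, 0 < M & forall z, `|c z| <= M.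
  have [M cM] := c_bnd; exists (`|M| + 1); first by rewrite ltr_wpDl.
  by move=> z; apply: le_trans (cM z) _; rewrite (le_trans (ler_norm M))// lerDl.
have Jfin z a b : measurable_fun setT a -> measurable_fun setT b ->
    Jcost c Q1 Q2 z a b \is a fin_num.
  by move=> ma mb; rewrite (JcostE hX hU1 hU2 c c_cont M).
apply: (saddle_value_cvg [set a | measurable_fun setT a]
  [set b | measurable_fun setT b] (fun m => Jcost c Q1 Q2 (zetas m))).
- by move=> m; exact: Jfin.
- exact: Jfin.
- move=> e e0.
  exact: (Jcost_uniform_cvg hX hU1 hU2 c c_cont M).
- exact: g_saddle.
- exact: gs_saddle.
Qed.
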